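(* Let $S$ be a set of $n$ points in the plane in convex position. Then the number of non-crossing path partitions without singletons (ncpws partitions) that $S$ admits is $\mathcal{O}^*(4.610718614^n)$.
   Context: A non-crossing graph on a finite point set $S$ in the plane is a graph with vertex set $S$ whose edges are straight line segments, no two of which cross. A non-crossing path partition without singletons (ncpws partition) of $S$ is a non-crossing graph on $S$ every connected component of which is a path with at least one edge (i.e. every point of $S$ belongs to a path of length at least $1$; no isolated vertices). The notation $\mathcal{O}^*(c^n)$ means $O(p(n)\,c^n)$ for some polynomial $p$, i.e. polynomial factors are neglected. *)

(* Defs.v *)
From HB Require Import structures.
From mathcomp Require Import all_boot all_order all_algebra.
From mathcomp Require Import boolp reals.
Set Implicit Arguments. Unset Strict Implicit. Unset Printing Implicit Defensive.
Import Order.TTheory GRing.Theory Num.Theory.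
Local Open Scope ring_scope.

Section Geom.
Variable R : realType.
Definition point := (R * R)%type.

Definition on_segment (a b x : point) : Prop :=
  exists t : R, 0 <= t /\ t <= 1 /\
    x = ((1 - t) * a.1 + t * b.1, (1 - t) * a.2 + t * b.2).

Definition convex_position (n : nat) (p : 'I_n -> point) : Prop :=
  injective p /\
  forall i : 'I_n, ~ exists w : 'I_n -> R,
    [/\ (forall j, 0 <= w j), w i = 0, \sum_j w j = 1 &
        p i = (\sum_j w j * (p j).1, \sum_j w j * (p j).2)].

(* A graph on the vertex set 'I_n is given by its edge set, a set of
   2-element subsets {i, j}. Edges are drawn as straight segments p i p j.
   Non-crossing: two distinct edges share no point other than a common endpoint. *)
Definition non_crossing (n : nat) (p : 'I_n -> point) (E : {set {set 'I_n}}) : Prop :=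
  forall i j k l : 'I_n,
    [set i; j] \in E -> [set k; l] \in E -> [set i; j] != [set k; l] ->
    forall x : point, on_segment (p i) (p j) x -> on_segment (p k) (p l) x ->
      exists m : 'I_n, [/\ m \in [set i; j], m \in [set k; l] & x = p m].

End Geom.

Definition path_edges (n : nat) (s : seq 'I_n) : {set {set 'I_n}} :=
  [set e | has (fun ab : 'I_n * 'I_n => e == [set ab.1; ab.2]) (zip s (behead s))].

(* E is a path partition without singletons: E is the union of the edge sets of
   vertex-disjoint simple paths, each having at least one edge (>= 2 vertices),
   which together cover every vertex. (The components of E are exactly these paths.) *)
Definition path_partition_ws (n : nat) (E : {set {set 'I_n}}) : Prop :=
  exists P : seq (seq 'I_n),
    [/\ uniq (flatten P), (forall v : 'I_n, v \in flatten P),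
        all (fun s => 2 <= size s)%N P &
        E = \bigcup_(s <- P) path_edges s].

Definition ncpws (R : realType) (n : nat) (p : 'I_n -> point R) (E : {set {set 'I_n}}) : Prop :=
  non_crossing p E /\ path_partition_ws E.

Definition num_ncpws (R : realType) (n : nat) (p : 'I_n -> point R) : nat :=
  #|[set E : {set {set 'I_n}} | `[< ncpws p E >] ]|.

(* Main.v *)
(* Ordering the points counterclockwise turns non-crossing into "no two edges
   interlace".  Inside a path, the least vertex v splits it into two arms lying
   one after the other, and each arm visits at every step the least or the
   greatest of its remaining vertices; so the path is determined by its vertex
   set, the length of one arm and one bit per remaining step.  Writing these data
   at the position of v (and a blank elsewhere) encodes the partition injectively
   by a word: reading from left to right, a blank position belongs to the latest
   path that is not yet complete.  With T = u / (1 - 2 u) the letters have weighted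
   count at most 1 + u (T + T^2) when a path on k vertices has weight u^k, and the
   weights of a word multiply to u^n, so there are at most
   ((1 + u (T + T^2)) / u)^n words for every 0 < u < 1/2. *)
Require Import Defs.
From HB Require Import structures.
From mathcomp Require Import all_boot all_order all_algebra.
From mathcomp Require Import boolp reals.
From mathcomp Require Import zify lra ring.
Import Order.TTheory GRing.Theory Num.Theory.
Set Implicit Arguments. Unset Strict Implicit. Unset Printing Implicit Defensive.
Local Open Scope nat_scope.

(** * Non-crossing paths on an ordered vertex set *)

Definition adj (T : eqType) (s : seq T) (a b : T) : bool :=
  infix [:: a; b] s || infix [:: b; a] s.

Lemma adjC (T : eqType) (s : seq T) a b : adj s a b = adj s b a.
Proof. exact: orbC. Qed.

Lemma adj_rev (T : eqType) (s : seq T) a b : adj (rev s) a b = adj s a b.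
Proof. by rewrite /adj -(infix_rev _ (rev s)) -(infix_rev [:: b; a]) revK orbC. Qed.

Lemma adj_catl (T : eqType) (s1 s2 : seq T) a b : adj s1 a b -> adj (s1 ++ s2) a b.
Proof. by case/orP => h; rewrite /adj (infix_catr _ h) ?orbT. Qed.

Lemma adj_catr (T : eqType) (s1 s2 : seq T) a b : adj s2 a b -> adj (s1 ++ s2) a b.
Proof. by case/orP => h; rewrite /adj (infix_catl _ h) ?orbT. Qed.

Lemma adj_cons2 (T : eqType) (s : seq T) a b : adj [:: a, b & s] a b.
Proof. by rewrite (adj_catl (s1 := [:: a; b])) // /adj infix_refl. Qed.

Lemma adj_mem (T : eqType) (s : seq T) a b : adj s a b -> (a \in s) && (b \in s).
Proof.
by case/orP => /mem_infix h; rewrite !h // !inE eqxx ?orbT.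
Qed.

(** Connectedness of a path, in the form that keeps a whole path on one side of a chord. *)
Lemma adj_const (T : eqType) (Q : pred T) (s : seq T) :
  (forall a b, adj s a b -> Q a = Q b) -> {in s &, forall x y, Q x = Q y}.
Proof.
elim: s => [|z [|z' s] IH] // adjQ.
  by move=> x y; rewrite !inE => /eqP -> /eqP ->.
have {}IH : {in z' :: s &, forall x y, Q x = Q y}.
  by apply: IH => a b ab; apply: adjQ; rewrite (adj_catr [:: z]).
have hz x : x \in z :: z' :: s -> Q x = Q z'.
  rewrite inE => /orP[/eqP ->|/IH /(_ (mem_head _ _)) //].
  by apply: adjQ; apply: adj_cons2.
by move=> x y /hz -> /hz ->.
Qed.

(** As [adj] is symmetric, these two patterns cover all interlacings of two edges. Edges with a
    common endpoint never interlace, so [s = s'] is allowed. *)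
Definition noncross (s s' : seq nat) : Prop := forall a b c d,
  adj s a c -> adj s' b d -> ~~ ([&& a < b, b < c & c < d]) && ~~ ([&& b < a, a < d & d < c]).

Lemma noncross_sub s s' t t' :
  (forall a b, adj t a b -> adj s a b) -> (forall a b, adj t' a b -> adj s' a b) ->
  noncross s s' -> noncross t t'.
Proof. by move=> st st' nc a b c d /st ac /st' bd; apply: nc. Qed.

(** An edge of [s'] with one end strictly between [x] and [y] and the other outside would interlace
    the chord [x y]; connectedness of [s'] does the rest. *)
Lemma noncross_side s s' x y : noncross s s' -> adj s x y -> x \notin s' -> y \notin s' ->
  {in s' &, forall b d, (x < b < y) = (x < d < y)}.
Proof.
move=> nc xy xs' ys'; apply: (adj_const (Q := fun b => x < b < y)) => b d bd.
have /andP[bs' ds'] := adj_mem bd.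
have neq z w : z \notin s' -> w \in s' -> z != w by move=> zs ws; apply: contraNneq zs => ->.
have := neq _ _ xs' bs'; have := neq _ _ xs' ds'; have := neq _ _ ys' bs'; have := neq _ _ ys' ds'.
have := nc _ _ _ _ xy bd; rewrite adjC in bd; have := nc _ _ _ _ xy bd.
lia.
Qed.

(** From edges to whole disjoint paths. No edge of [s] separates [b] from [d], so moving along [s]
    from [a] to [c] never enters or leaves the interval between [b] and [d]. *)
Lemma noncross_interlace s s' a b c d : noncross s s' -> ~~ has (mem s) s' ->
  a \in s -> c \in s -> b \in s' -> d \in s' -> ~~ ([&& a < b, b < c & c < d]).
Proof.
move=> nc dis as_ cs bs' ds'.
have ns z w : z \in s -> w \in s' -> z != w.
  by move=> zs ws'; apply: contraNneq dis => zw; apply/hasP; exists w; rewrite //= -zw.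
have ns' z : z \in s -> z \notin s'.
  by move=> zs; apply/negP => /(ns _ _ zs); rewrite eqxx.
apply/negP => abcd.
have : (b < a < d) = (b < c < d).
  apply: (adj_const (Q := fun x => b < x < d) (s := s)) => // x y xy.
  have /andP[xs ys] := adj_mem xy.
  have := noncross_side nc xy (ns' _ xs) (ns' _ ys) bs' ds'.
  rewrite adjC in xy; have := noncross_side nc xy (ns' _ ys) (ns' _ xs) bs' ds'.
  have := ns _ _ xs bs'; have := ns _ _ xs ds'; have := ns _ _ ys bs'; have := ns _ _ ys ds'.
  lia.
lia.
Qed.

(** * Sequences that always visit an extreme remaining vertex *)

Fixpoint extremal (s : seq nat) : bool :=
  if s is x :: t then (all (ltn x) t || all (gtn x) t) && extremal t else true.

(** In an extremal sequence the bit of a vertex tells whether it is the least or the greatest of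
    those left. The last vertex has no bit. *)
Definition updown (s : seq nat) : seq bool :=
  if s is x :: t then pairmap ltn x t else [::].

Lemma size_updown s : size (updown s) = (size s).-1.
Proof. by case: s => //= x s; rewrite size_pairmap. Qed.

(** Equal first bits make both heads the minimum, or both the maximum, of the same set; the heads
    agree and induction treats the tails. *)
Lemma extremal_inj s s' : extremal s -> extremal s' -> s =i s' -> updown s = updown s' -> s = s'.
Proof.
elim: s s' => [|x t IH] [|x' t'] //.
- by move=> _ _ /(_ x'); rewrite mem_head.
- by move=> _ _ /(_ x); rewrite mem_head.
move=> /= /andP[ext_x ext_t] /andP[ext_x' ext_t'] eq_m eq_b.
have sz : size t = size t' by rewrite -(size_pairmap ltn x t) eq_b size_pairmap.
have xE : x = x'.
  case: t t' sz ext_x ext_x' eq_m eq_b {IH ext_t ext_t'} => [|y t] [|y' t'] // _.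
    by move=> _ _ /(_ x); rewrite !inE eqxx => /esym/eqP.
  move=> /orP[] /allP h1 /orP[] /allP h2 eq_m [] /= eq_y _;
    have := h1 y (mem_head _ _); have := h2 y' (mem_head _ _);
    have := eq_m x; have := eq_m x'; rewrite [x \in _]mem_head [x' \in x' :: _]mem_head;
    rewrite inE => /orP[/eqP -> //|/h1 /= x'x] /esym;
    rewrite inE => /orP[/eqP -> //|/h2 /= xx']; lia.
have notin z s : all (ltn z) s || all (gtn z) s -> z \notin s.
  by case/orP => /allP h; apply/negP => /h /=; rewrite ltnn.
rewrite -xE in eq_b eq_m ext_x' *; congr cons; apply: IH => //.
- move=> z; have := eq_m z; rewrite !inE.
  by have [-> _|//] := eqVneq z x; rewrite !(negbTE (notin _ _ _)).
- by case: t t' sz eq_b {ext_x ext_x' ext_t ext_t' eq_m} => [|y t] [|y' t'] //= _ [].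
Qed.

(* The next vertex of a path whose last vertex lies outside the hull of the
   remaining ones must be extremal, as the step leading to it would otherwise
   separate the remaining vertices. *)
Lemma extremal_arm p t : uniq (p :: t) -> noncross (p :: t) (p :: t) ->
  all (ltn p) t || all (gtn p) t -> extremal t.
Proof.
elim: t p => [//|x t IH] p upt nc out.
have /and3P[pxt xt ut] := upt.
have pt : p \notin t by apply: contra pxt => pt; rewrite inE pt orbT.
have ext_x : all (ltn x) t || all (gtn x) t.
  have nct : noncross (p :: x :: t) t.
    apply: noncross_sub nc => // a b ab.
    exact: (adj_catr [:: p; x]).
  have side := noncross_side nct (adj_cons2 _ _ _) pt xt.
  have px : adj (p :: x :: t) x p by rewrite adjC adj_cons2.
  have side' := noncross_side nct px xt pt.
  case: t xt pt out side side' {IH upt nc pxt ut nct px} => [//|y t] xt pt out side side'.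
  have ne z : z \in y :: t -> x != z by move=> zt; apply: contraNneq xt => ->.
  have mem_y : y \in y :: t by rewrite mem_head.
  have yx := ne _ mem_y.
  have [xy|xy] := ltnP x y; apply/orP; [left|right]; apply/allP => z zt /=;
    have := side _ _ mem_y zt; have := side' _ _ mem_y zt; have := ne _ zt;
    case/orP: out => /allP h; have := h x (mem_head _ _);
    have := h y; rewrite inE mem_y orbT; have := h z; rewrite inE zt orbT;
    move=> /(_ isT) /= + /(_ isT) /=; lia.
rewrite /= ext_x /=; apply: (IH x) => //; first by rewrite /= xt.
by apply: noncross_sub nc => a b; apply: (adj_catr [:: p]).
Qed.

(** * Splitting a path at its least vertex *)

Definition lo (s : seq nat) : nat := head 0 (sort leq s).

Lemma lo_mem s : s != [::] -> lo s \in s.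
Proof.
move=> s0; rewrite -(mem_sort leq) /lo.
have : size (sort leq s) != 0 by rewrite size_sort size_eq0.
by case: (sort leq s) => //= x t _; rewrite mem_head.
Qed.

Lemma lo_min s x : x \in s -> lo s <= x.
Proof.
rewrite -(mem_sort leq) /lo; have := sort_sorted leq_total s.
case: (sort leq s) => //= y t; rewrite (path_sortedE leq_trans) => /andP[/allP h _].
by rewrite inE => /orP[/eqP ->|/h].
Qed.

Lemma lo_eq s v : v \in s -> {in s, forall x, v <= x} -> lo s = v.
Proof.
move=> vs vmin; apply/eqP; rewrite eqn_leq lo_min // vmin // lo_mem //.
by case: s vs {vmin}.
Qed.

(** The reversal makes both arms read outwards from [lo s]. *)
Definition larm (s : seq nat) : seq nat := rev (take (index (lo s) s) s).
Definition rarm (s : seq nat) : seq nat := drop (index (lo s) s).+1 s.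

Lemma arms_split s : s != [::] -> s = rev (larm s) ++ lo s :: rarm s.
Proof.
move=> s0; rewrite revK /rarm -{1}(cat_take_drop (index (lo s) s) s).
by rewrite [drop (index _ _) s](drop_nth 0) ?index_mem ?lo_mem // nth_index ?lo_mem.
Qed.

Lemma arms_cat L v R : all (ltn v) (L ++ R) ->
  [/\ lo (rev L ++ v :: R) = v, larm (rev L ++ v :: R) = L & rarm (rev L ++ v :: R) = R].
Proof.
rewrite all_cat => /andP[/allP vL /allP vR].
have loE : lo (rev L ++ v :: R) = v.
  apply: lo_eq => [|x]; first by rewrite mem_cat mem_head orbT.
  by rewrite mem_cat mem_rev inE => /or3P[/vL /ltnW|/eqP ->|/vR /ltnW].
have idx : index v (rev L ++ v :: R) = size (rev L).
  rewrite index_cat mem_rev /= eqxx addn0; case: ifP => // /vL /=.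
  by rewrite ltnn.
rewrite /larm /rarm loE idx take_size_cat // revK; split=> //.
by rewrite -cat_rcons drop_size_cat // size_rcons.
Qed.

Lemma head_mem (s : seq nat) : s != [::] -> head 0 s \in s.
Proof. by case: s => // x s _; rewrite mem_head. Qed.

Lemma adj_head v (s : seq nat) : s != [::] -> adj (v :: s) v (head 0 s).
Proof. by case: s => // x s _; apply: adj_cons2. Qed.

(** Fixes an orientation, since a path and its reverse have the same edges: the right arm is
    nonempty and lies above the left one. *)
Definition normal (s : seq nat) : bool :=
  [&& rarm s != [::], all (ltn (lo s)) (larm s ++ rarm s),
      extremal (larm s), extremal (rarm s) & allrel ltn (larm s) (rarm s)].

(** [extremal_arm] applies to both arms because [v] lies below them. For their order, let [a < b] be
    their heads: the chord [v b] keeps [L] below [b], and the chord [v a] keeps [R] above [a]. A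
    pair [r < l] with [r] in [R] and [l] in [L] would give [a < r < l < b], an interlacing of [L]
    and [R]. *)
Lemma normal_cat L v R : uniq (rev L ++ v :: R) -> all (ltn v) (L ++ R) -> R != [::] ->
  (L == [::]) || (head 0 L < head 0 R) -> noncross (rev L ++ v :: R) (rev L ++ v :: R) ->
  normal (rev L ++ v :: R).
Proof.
move=> us vLR R0 LR nc; rewrite /normal; have [-> -> ->] := arms_cat vLR.
rewrite R0 vLR /=.
have sub_vR a b : adj (v :: R) a b -> adj (rev L ++ v :: R) a b by exact: adj_catr.
have sub_vL a b : adj (v :: L) a b -> adj (rev L ++ v :: R) a b.
  by rewrite -adj_rev rev_cons -cat_rcons; apply: adj_catl.
have sub_R a b : adj R a b -> adj (rev L ++ v :: R) a b.
  by move=> ab; apply: sub_vR; apply: (adj_catr [:: v]).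
have sub_L a b : adj L a b -> adj (rev L ++ v :: R) a b.
  by move=> ab; apply: sub_vL; apply: (adj_catr [:: v]).
have := us; rewrite cat_uniq rev_uniq /= => /and3P[uL /norP[vL LRdis] /andP[vR uR]].
rewrite mem_rev in vL.
have := vLR; rewrite all_cat => /andP[vltL vltR].
rewrite (@extremal_arm v L) ?vltL //=; last first.
- exact: noncross_sub nc.
- by rewrite vL.
rewrite (@extremal_arm v R) ?vltR //=; last first.
- exact: noncross_sub nc.
- by rewrite vR.
have [-> //|L0] := eqVneq L [::].
rewrite (negbTE L0) /= in LR; move: (head_mem L0) (head_mem R0) LR.
have va := sub_vL _ _ (adj_head v L0); have vb := sub_vR _ _ (adj_head v R0).
move: (head 0 L) (head 0 R) va vb => a b va vb aL bR ab.
have dis x : x \in R -> x \notin L.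
  by move=> xR; apply: contra LRdis => xL; apply/hasP; exists x; rewrite //= mem_rev.
have dis' x : x \in L -> x \notin R by move=> xL; apply/negP => /dis; rewrite xL.
have ncL : noncross (rev L ++ v :: R) L by apply: noncross_sub nc.
have ncR : noncross (rev L ++ v :: R) R by apply: noncross_sub nc.
have vltL' x : x \in L -> v < x by move/(allP vltL).
have vltR' x : x \in R -> v < x by move/(allP vltR).
have ltb l : l \in L -> l < b.
  move=> lL; have := noncross_side ncL vb vL (dis _ bR) lL aL.
  by rewrite ab (vltL' _ aL) => /andP[].
have gta r : r \in R -> a < r.
  move=> rR; have := noncross_side ncR va vR (dis' _ aL) rR bR.
  rewrite (vltR' _ rR) (vltR' _ bR) (ltnNge b) (ltnW ab) /= => /negbT.
  rewrite -leqNgt leq_eqVlt => /orP[/eqP ar|//].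
  by have := dis _ rR; rewrite -ar aL.
apply/allrelP => l r lL rR; rewrite /= ltnNge leq_eqVlt; apply/negP => /orP[/eqP rl|rl].
  by have := dis _ rR; rewrite rl lL.
have ncLR : noncross L R by apply: noncross_sub nc.
have disLR : ~~ has (mem L) R by apply/hasPn => x /dis.
have := noncross_interlace ncLR disLR aL lL rR bR.
by rewrite (gta _ rR) rl (ltb _ lL).
Qed.

(** Reversal exchanges the arms, so an empty arm, or else the arm with the smaller head, can be made
    the left one. *)
Lemma normal_or_rev s : uniq s -> 1 < size s -> noncross s s -> normal s || normal (rev s).
Proof.
move=> us s1 nc; have s0 : s != [::] by case: s s1 {us nc}.
have ncr : noncross (rev s) (rev s) by apply: noncross_sub nc => a b; rewrite adj_rev.
have := us; rewrite -rev_uniq => urs.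
have vLR : all (ltn (lo s)) (larm s ++ rarm s).
  apply/allP => x xLR /=; rewrite ltn_neqAle lo_min ?andbT; last first.
    by rewrite (arms_split s0) mem_cat mem_rev inE orbCA -mem_cat xLR orbT.
  apply: contraTneq xLR => <-; move: us; rewrite {1}(arms_split s0) cat_uniq /=.
  by case/and3P => _ /norP[+ _] /andP[+ _]; rewrite mem_cat mem_rev negb_or => -> ->.
have vRL : all (ltn (lo s)) (rarm s ++ larm s) by rewrite all_cat andbC -all_cat.
have sE := arms_split s0; have srE : rev s = rev (rarm s) ++ lo s :: larm s.
  by rewrite {1}sE rev_cat rev_cons revK cat_rcons.
move: (larm s) (rarm s) (lo s) sE srE vLR vRL s1 => L R v sE srE vLR vRL s1.
rewrite sE in us nc; rewrite srE in urs ncr.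
have [R0|R0] := eqVneq R [::].
  have L0 : L != [::] by apply: contraTneq s1 => L0; rewrite sE R0 L0.
  by rewrite srE normal_cat ?orbT // R0.
have [L0|L0] := eqVneq L [::].
  by rewrite {1}sE normal_cat // L0.
have [LR|RL] := ltnP (head 0 L) (head 0 R).
  by rewrite {1}sE normal_cat // LR orbT.
rewrite srE normal_cat ?orbT //; apply/orP; right.
rewrite ltn_neqAle RL andbT; move: us; rewrite cat_uniq => /and3P[_ /hasPn h _].
apply/eqP => RLE; have /negP[] : head 0 R \notin rev L.
  by apply: h; rewrite inE head_mem ?orbT.
by rewrite RLE mem_rev head_mem.
Qed.

(** * Encoding path systems by words *)

(** The option separates an empty left arm from one with a single vertex, which has no bits either.
    The right arm of a normal path is nonempty. *)
Definition code : Type := (option (seq bool) * seq bool)%type.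

Definition path_code (s : seq nat) : code :=
  (if larm s is [::] then None else Some (updown (larm s)), updown (rarm s)).

(** The number of vertices of the path: a nonempty arm has one vertex more than bits, and the least
    vertex adds one. *)
Definition code_size (c : code) : nat :=
  (if c.1 is Some b then (size b).+1 else 0) + (size c.2).+2.

Lemma code_sizeE s : normal s -> code_size (path_code s) = size s.
Proof.
move=> /and5P[r0 _ _ _ _]; have s0 : s != [::] by apply: contraNneq r0 => ->.
rewrite [in RHS](arms_split s0) size_cat size_rev /code_size /= size_updown.
case: (rarm s) r0 => //= b r _; case: (larm s) => //= a l.
by rewrite size_pairmap.
Qed.

Lemma normal_neq0 s : normal s -> s != [::].
Proof. by case/and5P => r0 _ _ _ _; apply: contraNneq r0 => ->. Qed.

Lemma mem_arms s : s != [::] -> s =i lo s :: larm s ++ rarm s.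
Proof.
by move=> s0 x; rewrite {1}(arms_split s0) mem_cat mem_rev !inE mem_cat orbCA.
Qed.

(** Left arms are initial segments of the vertices above [lo s]. If [x] in [larm s'] were in
    [rarm s], all of [larm s] would lie below [x], hence in [larm s'], which would then be too
    large. *)
Lemma larm_subset s s' : normal s -> normal s' -> uniq s -> s =i s' ->
  size (larm s) = size (larm s') -> {subset larm s' <= larm s}.
Proof.
move=> ns ns' us ss' szL x xL'; apply/negPn/negP => xL.
have [/and5P[_ /allP vs _ _ LR] /and5P[_ /allP vs' _ _ LR']] := (ns, ns').
have [s0 s0'] := (normal_neq0 ns, normal_neq0 ns').
have loE : lo s = lo s'.
  apply: lo_eq; first by rewrite ss' lo_mem.
  by move=> y; rewrite ss'; apply: lo_min.
have vx : lo s' < x by apply: vs'; rewrite mem_cat xL'.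
have xR : x \in rarm s.
  have : x \in s by rewrite ss' (mem_arms s0') inE mem_cat xL' orbT.
  by rewrite (mem_arms s0) inE mem_cat (negbTE xL) loE gtn_eqF.
have uL : uniq (larm s) by rewrite rev_uniq take_uniq.
suff sub : {subset x :: larm s <= larm s'}.
  by have := uniq_leq_size (_ : uniq (x :: larm s)) sub; rewrite /= xL szL ltnn => /(_ uL).
move=> y; rewrite inE => /orP[/eqP -> //|yL].
have yx : y < x by apply: (allrelP LR).
have : y \in s' by rewrite -ss' (mem_arms s0) inE mem_cat yL orbT.
have : lo s < y by apply: vs; rewrite mem_cat yL.
rewrite (mem_arms s0') inE mem_cat loE => vy; rewrite gtn_eqF //= => /orP[//|yR'].
by have := ltn_trans yx (allrelP LR' _ _ xL' yR'); rewrite ltnn.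
Qed.

Lemma path_code_inj s s' : normal s -> normal s' -> uniq s -> uniq s' -> s =i s' ->
  path_code s = path_code s' -> s = s'.
Proof.
move=> ns ns' us us' ss' [eqL eqR].
have [/and5P[_ /allP vs eL eR _] /and5P[_ /allP vs' eL' eR' _]] := (ns, ns').
have [s0 s0'] := (normal_neq0 ns, normal_neq0 ns').
have loE : lo s = lo s'.
  apply: lo_eq; first by rewrite ss' lo_mem.
  by move=> y; rewrite ss'; apply: lo_min.
have [szL udL] : size (larm s) = size (larm s') /\ updown (larm s) = updown (larm s').
  case: (larm s) (larm s') eqL => [|a l] [|a' l'] // [eqL]; split=> //.
  by rewrite /= -(size_pairmap ltn a l) eqL size_pairmap.
have LE : larm s = larm s'.
  apply: extremal_inj => // x; apply/idP/idP; last exact: larm_subset.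
  by apply: larm_subset => // y; rewrite ss'.
have memR t x : t != [::] -> uniq t -> (x \in rarm t) = [&& x \in t, x != lo t & x \notin larm t].
  move=> t0; rewrite {1}(arms_split t0) (mem_arms t0) cat_uniq rev_uniq /= inE mem_cat.
  case/and3P => _ /norP[_ /hasPn dis] /andP[vR _].
  case xR : (x \in rarm t); last first.
    by rewrite orbF; case: (x == lo t); case: (x \in larm t).
  have := dis _ xR; rewrite /= mem_rev => ->; rewrite !orbT andbT /=; apply/esym.
  by apply: contraNneq vR => <-.
have RE : rarm s = rarm s'.
  by apply: extremal_inj => // x; rewrite !memR // ss' loE LE.
by rewrite (arms_split s0) (arms_split s0') LE RE loE.
Qed.

(** The combinatorial form of a partition: points are replaced by their positions in cyclic order,
    and every path is stored in its normal orientation. *)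
Definition path_system (n : nat) (P : seq (seq nat)) : Prop :=
  [/\ uniq (flatten P), flatten P =i iota 0 n, all normal P &
      forall s s', s \in P -> s' \in P -> noncross s s'].

(** If no path starts at [i], the search yields the default [[::]], which cannot be confused with a
    normal path; it becomes the blank. *)
Definition word (P : seq (seq nat)) (i : nat) : option code :=
  let s := nth [::] P (find (fun s => lo s == i) P) in
  if s is [::] then None else Some (path_code s).

Definition block (P : seq (seq nat)) (i : nat) : seq nat :=
  nth [::] P (find (fun s => i \in s) P).

Lemma uniq_flatten_mem (T : eqType) (P : seq (seq T)) s s' x : uniq (flatten P) ->
  s \in P -> s' \in P -> x \in s -> x \in s' -> s = s'.
Proof.
elim: P => //= t P IH; rewrite cat_uniq => /and3P[_ /hasPn dis uP].
have nt u : u \in P -> x \in u -> x \notin t.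
  by move=> uP' xu; apply: dis; apply/flattenP; exists u.
rewrite !inE => /orP[/eqP ->|sP] /orP[/eqP ->|sP'] xs xs' //.
- by have := nt _ sP' xs'; rewrite xs.
- by have := nt _ sP xs; rewrite xs'.
- exact: IH.
Qed.

Lemma uniq_flatten_sub (T : eqType) (P : seq (seq T)) s : uniq (flatten P) -> s \in P -> uniq s.
Proof.
elim: P => //= t P IH; rewrite cat_uniq inE => /and3P[ut _ uP] /orP[/eqP ->//|].
exact: IH.
Qed.

(** * Reading a path system from left to right *)

Section PathSystem.
Variables (n : nat) (P : seq (seq nat)).
Hypothesis Psys : path_system n P.

Lemma blockE s i : s \in P -> i \in s -> block P i = s.
Proof.
move=> sP is_; have [uP _ _ _] := Psys; rewrite /block.
have hasi : has (fun s => i \in s) P by apply/hasP; exists s.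
apply: (uniq_flatten_mem uP) is_; rewrite ?mem_nth -?has_find //.
exact: (nth_find [::] hasi).
Qed.

Lemma block_mem i : i < n -> block P i \in P /\ i \in block P i.
Proof.
move=> lt_in; have [_ mP _ _] := Psys.
have : i \in flatten P by rewrite mP mem_iota add0n.
by case/flattenP => s sP is_; rewrite (blockE sP is_).
Qed.

Lemma path_lt s i : s \in P -> i \in s -> i < n.
Proof.
move=> sP is_; have [_ mP _ _] := Psys.
by have : i \in flatten P; [apply/flattenP; exists s|rewrite mP mem_iota add0n].
Qed.

Lemma path_normal s : s \in P -> normal s.
Proof. by have [_ _ /allP nP _] := Psys; apply: nP. Qed.

Lemma path_lo_mem s : s \in P -> lo s \in s.
Proof. by move=> /path_normal /normal_neq0 /lo_mem. Qed.

Lemma path_uniq s : s \in P -> uniq s.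
Proof. by have [uP _ _ _] := Psys; apply: uniq_flatten_sub. Qed.

Lemma lo_inj s s' : s \in P -> s' \in P -> lo s = lo s' -> s = s'.
Proof.
move=> sP s'P loE; have [uP _ _ _] := Psys.
by apply: (uniq_flatten_mem uP sP s'P (path_lo_mem sP)); rewrite loE path_lo_mem.
Qed.

Lemma word_lo s : s \in P -> word P (lo s) = Some (path_code s).
Proof.
move=> sP; rewrite /word; set t := nth _ _ _.
have hass : has (fun t => lo t == lo s) P by apply/hasP; exists s.
have tP : t \in P by rewrite mem_nth // -has_find.
have -> : t = s by apply: lo_inj => //; apply/eqP/(nth_find [::] hass).
by case: (s) (normal_neq0 (path_normal sP)).
Qed.

Lemma word_Some i c : word P i = Some c -> exists s, [/\ s \in P, lo s = i & c = path_code s].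
Proof.
rewrite /word; set t := nth _ _ _ => wi.
have lt_t : find (fun s => lo s == i) P < size P.
  by rewrite ltnNge; apply/negP => h; move: wi; rewrite /t nth_default.
exists t; split; first exact: mem_nth.
  by apply/eqP; apply: (nth_find [::] (a := fun s => lo s == i)); rewrite has_find.
by case: (t) wi => // ? ? [].
Qed.

Lemma count_block s i : s \in P -> i <= n ->
  count (fun j => lo (block P j) == lo s) (iota 0 i) = count (mem s) (iota 0 i).
Proof.
move=> sP le_in; apply: eq_in_count => j; rewrite mem_iota add0n => /= ltji.
have [bP jb] := block_mem (leq_trans ltji le_in).
apply/eqP/idP => [/(lo_inj bP sP) <- //|js].
by rewrite (blockE sP js).
Qed.

(** Incompleteness of a path before position [i] becomes a comparison of the positions counted so
    far with the size announced by its letter. *)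
Lemma count_lt_size s i : s \in P ->
  (count (mem s) (iota 0 i) < size s) = has (leq i) s.
Proof.
move=> sP; have us := path_uniq sP; rewrite -size_filter.
have uf : uniq (filter (mem s) (iota 0 i)) by rewrite filter_uniq ?iota_uniq.
apply/idP/hasP => [lt_fs|[j js /= le_ij]].
  apply/hasP; apply/negPn/negP => /hasPn h; move: lt_fs; rewrite ltnNge => /negP; apply.
  apply: uniq_leq_size => // j js; rewrite mem_filter mem_iota add0n /= js.
  by have := h _ js; lia.
have : uniq (j :: filter (mem s) (iota 0 i)).
  by rewrite /= uf andbT mem_filter mem_iota; lia.
move/uniq_leq_size; apply => k; rewrite inE mem_filter => /orP[/eqP -> //|].
by case/andP.
Qed.

(** The starting position serves as the name of a path, since distinct paths start at distinct
    positions. *)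
Definition low (i : nat) : nat := lo (block P i).

Definition wsize (o : option code) : nat := if o is Some c then code_size c else 0.

Lemma low_le i : i < n -> low i <= i.
Proof. by move=> /block_mem[_ ib]; apply: lo_min. Qed.

Lemma low_word i : i < n -> (low i == i) = (word P i != None).
Proof.
move=> lt_in; have [bP ib] := block_mem lt_in; apply/eqP/idP => [loi|].
  by rewrite -loi word_lo.
case wi: (word P i) => [c|//] _; have [s [sP los _]] := word_Some wi.
by rewrite /low -los (blockE sP) // path_lo_mem.
Qed.

Lemma low_open i : i < n ->
  count (fun j => low j == low i) (iota 0 i) < wsize (word P (low i)).
Proof.
move=> lt_in; have [bP ib] := block_mem lt_in.
rewrite word_lo // /= code_sizeE ?path_normal // count_block ?(ltnW lt_in) //.
by rewrite count_lt_size //; apply/hasP; exists i.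
Qed.

(* An open path starting between [low i] and [i] would interlace the path of [i]. *)
Lemma low_max i m : i < n -> low i < m -> m < i ->
  wsize (word P m) <= count (fun j => low j == m) (iota 0 i).
Proof.
move=> lt_in lt_m lt_mi; have [bP ib] := block_mem lt_in.
case wm: (word P m) => [c|//]; have [s [sP los ->]] := word_Some wm.
rewrite /= code_sizeE ?path_normal // -los count_block ?(ltnW lt_in) // leqNgt.
rewrite count_lt_size //; apply/hasPn => j js /=; rewrite -ltnNge ltnNge leq_eqVlt negb_or.
have disj k : k \in s -> k \notin block P i.
  by move=> ks; apply/negP => kb; move: lt_m; rewrite /low -(blockE bP kb) (blockE sP ks) los ltnn.
apply/andP; split; first by apply: contraTneq ib => ij; rewrite {1}ij disj.
apply/negP => lt_ij; have [_ _ _ /(_ _ _ bP sP) nc] := Psys.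
have dis : ~~ has (mem (block P i)) s by apply/hasPn => k /disj.
have := noncross_interlace nc dis (path_lo_mem bP) ib (path_lo_mem sP) js.
by rewrite los lt_ij lt_mi -/(low i) lt_m.
Qed.

End PathSystem.

(** Decoding by strong induction. A nonblank position starts its own path. A blank one belongs to
    the latest path still open, and openness depends only on the word and on [low] at earlier
    positions. If the two values differed, the path starting at the larger would be open by
    [low_open] and complete by [low_max]. *)
Lemma low_eq n P P' : path_system n P -> path_system n P' ->
  (forall i, i < n -> word P i = word P' i) -> forall i, i < n -> low P i = low P' i.
Proof.
move=> sysP sysP' eqw; elim/ltn_ind => i IH lt_in.
have [wi|wi] := eqVneq (word P i) None; last first.
  have := wi; rewrite -(low_word sysP) // => /eqP ->.
  by move: wi; rewrite eqw // -(low_word sysP') // => /eqP ->.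
have cntE m : count (fun j => low P j == m) (iota 0 i) = count (fun j => low P' j == m) (iota 0 i).
  by apply: eq_in_count => j; rewrite mem_iota add0n => /= lt_ji; rewrite IH // (ltn_trans lt_ji).
have lt_low Q : path_system n Q -> word Q i = None -> low Q i < i.
  by move=> sysQ wQ; rewrite ltn_neqAle (low_le sysQ) // (low_word sysQ) // wQ.
have ltP := lt_low _ sysP wi; have ltP' : low P' i < i by rewrite lt_low -?eqw.
apply/eqP; rewrite eqn_leq; apply/andP; split; rewrite leqNgt; apply/negP => lt.
- have := low_open sysP lt_in.
  by rewrite cntE eqw ?(ltn_trans ltP) // ltnNge (low_max sysP').
- have := low_open sysP' lt_in.
  by rewrite -cntE -eqw ?(ltn_trans ltP') // ltnNge (low_max sysP).
Qed.

(** The word fixes [low], hence the vertex set of each path, and the letter at its start fixes the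
    rest. Inclusion is the right form, as the listing order of the paths is not encoded. *)
Lemma word_inj n P P' : path_system n P -> path_system n P' ->
  (forall i, i < n -> word P i = word P' i) -> {subset P <= P'}.
Proof.
move=> sysP sysP' eqw s sP; have los := path_lo_mem sysP sP.
have lon := path_lt sysP sP los.
have := word_lo sysP sP; rewrite eqw // => /(word_Some)[s' [s'P loE shE]].
suff -> : s = s' by [].
apply: (path_code_inj (path_normal sysP sP) (path_normal sysP' s'P)
  (path_uniq sysP sP) (path_uniq sysP' s'P) _ shE) => j.
have low_mem Q t : path_system n Q -> t \in Q -> j < n -> (j \in t) = (low Q j == lo t).
  move=> sysQ tQ jn; have [bQ jb] := block_mem sysQ jn.
  apply/idP/eqP => [jt|/(lo_inj sysQ bQ tQ) <- //].
  by rewrite /low (blockE sysQ tQ jt).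
have [jn|jn] := ltnP j n.
  by rewrite (low_mem P) // (low_mem P') // loE (low_eq sysP sysP').
by apply/idP/idP => [/(path_lt sysP sP)|/(path_lt sysP' s'P)]; rewrite ltnNge jn.
Qed.

Lemma sum_wsize n P : path_system n P -> \sum_(i < n) wsize (word P i) <= n.
Proof.
move=> sysP; have [uP mP _ _] := sysP.
have nE : n = \sum_(s <- P) size s.
  rewrite -(big_map size xpredT id) -sumnE -size_flatten -[LHS](size_iota 0).
  by apply/perm_size/uniq_perm; rewrite ?iota_uniq // => x; rewrite mP.
(* The path sizes are regrouped by starting position. *)
have : n = \sum_(i < n) \sum_(s <- P | lo s == i) size s.
  rewrite [LHS]nE [RHS](exchange_big_dep xpredT) //= big_seq [RHS]big_seq; apply: eq_bigr => s sP.
  rewrite (big_pred1 (Ordinal (path_lt sysP sP (path_lo_mem sysP sP)))) //.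
move=> sumE; rewrite [leqRHS]sumE; apply: leq_sum => i _; case wi: (word P i) => [c|//].
have [s [sP los ->]] := word_Some wi.
by rewrite /= code_sizeE ?(path_normal sysP) // (big_rem s) //= los eqxx leq_addr.
Qed.

(** * Weighted count of words *)

(** A finite alphabet, over which words can be summed. Letters of size at most [n] have bit
    sequences short enough to survive the truncation. *)
Definition bcode (n : nat) : finType := option (option (n.-bseq bool) * n.-bseq bool).

Definition bounded_code (n : nat) (o : option code) : bcode n :=
  omap (fun c : code => (omap (fun b => insub_bseq n b) c.1, insub_bseq n c.2)) o.

Definition bcode_size (n : nat) (o : bcode n) : nat :=
  wsize (omap (fun c => (omap (@bseqval _ _) c.1, bseqval c.2)) o).

Lemma bounded_codeK n o : wsize o <= n ->
  omap (fun c => (omap (@bseqval _ _) c.1, bseqval c.2)) (bounded_code n o) = o.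
Proof.
have insubK (b : seq bool) : size b <= n -> bseqval (insub_bseq n b) = b.
  by move=> bn; apply: (insubdK (sT := n.-bseq bool)).
case: o => [[[bL|] bR]|] //=; rewrite /code_size /= => sz; congr (Some (_, _));
  rewrite ?insubK //; lia.
Qed.

Section Weights.
Variable R : realFieldType.
Local Open Scope ring_scope.

Lemma sum_option (T : finType) (F : option T -> R) :
  \sum_o F o = F None + \sum_t F (Some t).
Proof.
rewrite (bigD1 None) //=; congr (_ + _).
rewrite (reindex_omap Some id) /=; last by case.
by apply: eq_bigl => t; rewrite eqxx.
Qed.

Variable u : R.
Hypotheses (u0 : 0 < u) (u12 : 2 * u < 1).
(** The sum of the geometric series with terms [2 ^ k * u ^ (k + 1)]: the weighted count of nonempty
    arms, [k] being the number of bits. *)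
Let T := u / (1 - 2 * u).

Lemma sum_bits n : \sum_(b : n.-bseq bool) u ^+ (size b).+1 <= T.
Proof.
rewrite (reindex tagged_tuple_bseq) /=; last exact: onW_bij tagged_tuple_bseq_bij.
have -> : \sum_(t : {k : 'I_n.+1 & k.-tuple bool}) u ^+ (size (tagged_tuple_bseq t)).+1 =
    \sum_(k < n.+1) \sum_(t : k.-tuple bool) u ^+ k.+1.
  by rewrite sig_big_dep; apply: eq_bigr => t _; rewrite size_tuple.
under eq_bigr => i _ do
  rewrite sumr_const card_tuple card_bool -mulr_natl natrX exprS mulrCA -exprMn.
have := subrX1 (2 * u) n.+1.
rewrite -mulr_sumr /T; set S := \sum_(i < _) _ => eS.
have u2 : 0 < 1 - 2 * u by rewrite subr_gt0.
rewrite ler_pdivlMr // -mulrA ler_piMr ?(ltW u0) //.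
have : 0 <= (2 * u) ^+ n.+1 by rewrite exprn_ge0 ?mulr_ge0 ?ltW.
move: eS; lra.
Qed.

(** The blank contributes 1. Any other letter contributes [u] for the least vertex, a factor [1 + S]
    for the possibly empty left arm and [S] for the right arm. *)
Lemma sum_bcode n :
  \sum_(o : bcode n) u ^+ bcode_size o <= 1 + u * (T + T ^+ 2).
Proof.
rewrite sum_option expr0 lerD2l.
set S := \sum_(b : n.-bseq bool) u ^+ (size b).+1.
have -> : \sum_t u ^+ @bcode_size n (Some t) = u * ((1 + S) * S).
  rewrite -[1 + S](sum_option (fun o : option (n.-bseq bool) =>
    if o is Some b then u ^+ (size b).+1 else 1)).
  rewrite big_distrlr pair_bigA mulr_sumr; apply: eq_bigr => -[[bL|] bR] _ /=.
    by rewrite /bcode_size /= /code_size /= -exprD -exprS; congr (_ ^+ _); lia.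
  by rewrite /bcode_size /= /code_size /= mul1r -exprS.
have S0 : 0 <= S by apply: sumr_ge0 => b _; rewrite exprn_ge0 ?ltW.
have ST : S <= T := sum_bits n.
rewrite ler_pM2l //; nra.
Qed.

(** As [u <= 1], a word of total size at most [n] weighs at least [u ^+ n], while the total weight
    of all words factors over the positions. *)
Lemma card_words (n : nat) (D : finType) (A : {set D}) (f : D -> {ffun 'I_n -> bcode n}) :
  {in A &, injective f} ->
  (forall x, x \in A -> (\sum_i bcode_size (f x i) <= n)%N) ->
  #|A|%:R * u ^+ n <= (1 + u * (T + T ^+ 2)) ^+ n.
Proof.
move=> f_inj f_size.
have u1 : u <= 1 by move: u0 u12; lra.
pose W (g : {ffun 'I_n -> bcode n}) := \prod_i u ^+ bcode_size (g i).
have W0 g : 0 <= W g by apply: prodr_ge0 => i _; rewrite exprn_ge0 ?ltW.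
apply: (@le_trans _ _ (\sum_(x in A) W (f x))).
  rewrite mulr_natl -sumr_const; apply: ler_sum => x xA.
  by rewrite /W -expr_sum ler_wiXn2l ?f_size ?(ltW u0).
rewrite -(big_imset W f_inj) /=.
apply: (@le_trans _ _ (\sum_g W g)).
  rewrite [leRHS](bigID (mem (f @: A))) /= lerDl; exact: sumr_ge0.
rewrite /W -(bigA_distr_bigA (fun _ o => u ^+ bcode_size o)).
rewrite prodr_const card_ord; apply: lerXn2r; rewrite ?nnegrE; last exact: sum_bcode.
  by apply: sumr_ge0 => o _; rewrite exprn_ge0 ?ltW.
(* The bound is nonnegative because it dominates a sum of nonnegative weights. *)
by apply: le_trans (sum_bcode 0); apply: sumr_ge0 => o _; rewrite exprn_ge0 ?ltW.
Qed.

End Weights.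

(** * Cyclic order of points in convex position *)

Section Geometry.
Variable R : realType.
Local Open Scope ring_scope.

(** Twice the signed area of the triangle [a b c], positive when it is counterclockwise. *)
Definition orient (a b c : point R) : R :=
  (b.1 - a.1) * (c.2 - a.2) - (b.2 - a.2) * (c.1 - a.1).

Lemma orient_rot a b c : orient a b c = orient b c a.
Proof. rewrite /orient; ring. Qed.

Lemma orient_swap a b c : orient a c b = - orient a b c.
Proof. rewrite /orient; ring. Qed.

Lemma orient_split o a b c : orient a b c = orient o a b + orient o b c - orient o a c.
Proof. rewrite /orient; ring. Qed.

(** The indices [j], [k], [l] may coincide, so segments are covered too. *)
Lemma convex_not_hull n (p : 'I_n -> point R) (i j k l : 'I_n) (a b c : R) :
  convex_position p -> i != j -> i != k -> i != l -> 0 <= a -> 0 <= b -> 0 <= c ->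
  a + b + c = 1 ->
  p i <> (a * (p j).1 + b * (p k).1 + c * (p l).1, a * (p j).2 + b * (p k).2 + c * (p l).2).
Proof.
move=> [_ cp] ij ik il a0 b0 c0 abc1 pE; apply: (cp i).
have sumE (F : 'I_n -> R) :
    \sum_m (a * (m == j)%:R + b * (m == k)%:R + c * (m == l)%:R) * F m =
    a * F j + b * F k + c * F l.
  have one x (d : R) : \sum_m (d * (m == x)%:R) * F m = d * F x.
    rewrite (bigD1 x) //= eqxx mulr1 big1 ?addr0 // => m /negbTE ->.
    by rewrite mulr0 mul0r.
  by rewrite -!one -!big_split /=; apply: eq_bigr => m _; rewrite !mulrDl.
exists (fun m => a * (m == j)%:R + b * (m == k)%:R + c * (m == l)%:R); split.
- by move=> m; rewrite !addr_ge0 // mulr_ge0.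
- by rewrite (negbTE ij) (negbTE ik) (negbTE il) !mulr0 !addr0.
- have := sumE (fun=> 1); under eq_bigr => m _ do rewrite mulr1.
  by rewrite !mulr1 abc1.
- by rewrite !sumE.
Qed.

(* The three cofactors are the barycentric coordinates of [p i]. *)
Lemma convex_not_triangle n (p : 'I_n -> point R) (i j k l : 'I_n) :
  convex_position p -> i != j -> i != k -> i != l ->
  0 <= orient (p i) (p j) (p k) -> 0 <= orient (p i) (p k) (p l) ->
  0 <= orient (p i) (p l) (p j) ->
  orient (p j) (p k) (p l) <= 0.
Proof.
move=> cp ij ik il; set C := orient _ _ (p k); set A := orient _ (p k) _; set B := orient _ (p l) _.
move=> C0 A0 B0; rewrite leNgt; apply/negP => D0.
set D := orient _ _ _ in D0.
have ABC : A + B + C = D.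
  by rewrite /D (orient_split (p i)) -/A -/C (orient_swap (p i) (p l)) -/B; ring.
have nz : D != 0 by rewrite gt_eqF.
apply: (@convex_not_hull n p i j k l (A / D) (B / D) (C / D)) => //;
  rewrite ?divr_ge0 ?(ltW D0) //; first by rewrite -!mulrDl ABC divff.
have key x a b c : D * x = A * a + B * b + C * c -> x = A / D * a + B / D * b + C / D * c.
  by move=> e; apply: (mulfI nz); rewrite e; field.
by rewrite [LHS]surjective_pairing; congr pair; apply: key; rewrite /D /A /B /C /orient; ring.
Qed.

Definition dot (a b c : point R) : R :=
  (b.1 - a.1) * (c.1 - a.1) + (b.2 - a.2) * (c.2 - a.2).

(** Collinearity and an obtuse angle at [p i] would put [p i] on the segment from [p j] to [p k]. *)
Lemma convex_dot_ge0 n (p : 'I_n -> point R) (i j k : 'I_n) :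
  convex_position p -> i != j -> i != k -> j != k -> orient (p i) (p j) (p k) = 0 ->
  0 <= dot (p i) (p j) (p k).
Proof.
move=> cp ij ik jk o0; rewrite leNgt; apply/negP => di.
set dj := dot (p j) (p i) (p k); set dk := dot (p k) (p i) (p j).
have dot_gt0 a b c : dot a b c < 0 -> 0 < dot b a c.
  move=> d0; have -> : dot b a c = (a.1 - b.1) ^+ 2 + (a.2 - b.2) ^+ 2 - dot a b c.
    rewrite /dot; ring.
  by rewrite subr_gt0 (lt_le_trans d0) // addr_ge0 ?sqr_ge0.
have dj0 : 0 < dj := dot_gt0 _ _ _ di.
have dk0 : 0 < dk.
  by apply: dot_gt0; apply: le_lt_trans di; rewrite /dot le_eqVlt; apply/orP; left; apply/eqP; ring.
have dS : 0 < dj + dk := addr_gt0 dj0 dk0.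
have nz : dj + dk != 0 := lt0r_neq0 dS.
(* On a line these weights are the ratios of the distances from [p i] to the two ends over the
   length of the segment. *)
apply: (@convex_not_hull n p i j k k (dk / (dj + dk)) (dj / (dj + dk)) 0) => //.
- by apply: divr_ge0; apply: ltW.
- by apply: divr_ge0; apply: ltW.
- by rewrite addr0 -mulrDl [dk + dj]addrC divff.
have key x b c : (dj + dk) * x = dk * b + dj * c ->
    x = dk / (dj + dk) * b + dj / (dj + dk) * c + 0 * c.
  by move=> e; apply: (mulfI nz); rewrite e; field.
rewrite [LHS]surjective_pairing; congr pair; apply: key; apply/eqP; rewrite -subr_eq0; apply/eqP.
  transitivity (orient (p i) (p j) (p k) * ((p j).2 - (p k).2)); last by rewrite o0 mul0r.
  rewrite /dj /dk /dot /orient; ring.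
transitivity (orient (p i) (p j) (p k) * ((p k).1 - (p j).1)); last by rewrite o0 mul0r.
rewrite /dj /dk /dot /orient; ring.
Qed.

(** For collinear points the three dot products are nonnegative, and their pairwise products sum to
    the square of [orient], which is 0. So two of them vanish, although any two sum to a positive
    squared distance. *)
Lemma convex_orient_neq0 n (p : 'I_n -> point R) (i j k : 'I_n) :
  convex_position p -> i != j -> i != k -> j != k -> orient (p i) (p j) (p k) != 0.
Proof.
move=> cp ij ik jk; apply/eqP => o0.
have di := convex_dot_ge0 cp ij ik jk o0.
have dj : 0 <= dot (p j) (p k) (p i).
  by apply: convex_dot_ge0; rewrite // ?[_ == i]eq_sym // -orient_rot.
have dk : 0 <= dot (p k) (p i) (p j).
  by apply: convex_dot_ge0; rewrite // ?[k == _]eq_sym // orient_rot.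
have pos x y : x != y -> 0 < ((p x).1 - (p y).1) ^+ 2 + ((p x).2 - (p y).2) ^+ 2.
  move=> xy; rewrite lt_neqAle addr_ge0 ?sqr_ge0 // andbT eq_sym paddr_eq0 ?sqr_ge0 //.
  rewrite !sqrf_eq0 !subr_eq0; apply/negP => /andP[/eqP e1 /eqP e2].
  by have [inj _] := cp; case/eqP: xy; apply: inj;
    rewrite [LHS]surjective_pairing e1 e2 -surjective_pairing.
have pij := pos _ _ ij; have pik := pos _ _ ik; have pjk := pos _ _ jk.
have eij : 0 < dot (p i) (p j) (p k) + dot (p j) (p k) (p i) by move: pij; rewrite /dot; lra.
have eik : 0 < dot (p i) (p j) (p k) + dot (p k) (p i) (p j) by move: pik; rewrite /dot; lra.
have ejk : 0 < dot (p j) (p k) (p i) + dot (p k) (p i) (p j) by move: pjk; rewrite /dot; lra.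
have : dot (p i) (p j) (p k) * dot (p j) (p k) (p i) +
  dot (p i) (p j) (p k) * dot (p k) (p i) (p j) +
  dot (p j) (p k) (p i) * dot (p k) (p i) (p j) = 0.
  transitivity (orient (p i) (p j) (p k) ^+ 2); last by rewrite o0 expr0n.
  rewrite /dot /orient; ring.
move: (dot _ _ _) (dot _ _ _) (dot _ _ _) di dj dk eij eik ejk => x y z x0 y0 z0 xy xz yz e.
have xy0 : x * y = 0 by apply/eqP; rewrite eq_le mulr_ge0 // andbT; nra.
have xz0 : x * z = 0 by apply/eqP; rewrite eq_le mulr_ge0 // andbT; nra.
have yz0 : y * z = 0 by lra.
move/eqP: xy0; rewrite mulf_eq0 => /orP[] /eqP h.
  by move/eqP: yz0; rewrite mulf_eq0 => /orP[] /eqP h'; lra.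
by move/eqP: xz0; rewrite mulf_eq0 => /orP[] /eqP h'; lra.
Qed.

(** The points are sorted by angle around the point [o], which comes first. *)
Lemma cyclic_order n (p : 'I_n.+1 -> point R) : convex_position p ->
  exists s : seq 'I_n.+1, [/\ uniq s, size s = n.+1 &
    forall a b c, (a < b)%N -> (b < c)%N -> (c < n.+1)%N ->
      0 < orient (p (nth ord0 s a)) (p (nth ord0 s b)) (p (nth ord0 s c))].
Proof.
move=> cp; pose o : 'I_n.+1 := ord0.
pose ccw i j := 0 < orient (p o) (p i) (p j).
pose le i j := (i == o) || (j != o) && ((i == j) || ccw i j).
have ccwC i j : ccw i j -> ~~ ccw j i.
  by rewrite /ccw => h; rewrite orient_swap oppr_gt0 -leNgt ltW.
have ccw_trans i j k : i != o -> j != o -> k != o -> ccw i j -> ccw j k -> ccw i k.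
  move=> io jo ko ij jk; have ik : i != k by apply: contraTneq jk => <-; apply: ccwC.
  have := convex_orient_neq0 cp (_ : o != i) (_ : o != k) ik.
  rewrite ![o == _]eq_sym => /(_ io ko); rewrite /ccw lt_neqAle eq_sym => -> /=.
  rewrite leNgt; apply/negP => ki.
  (* A failure of transitivity would put [p o] inside the triangle of [i], [j], [k]. *)
  have := @convex_not_triangle n.+1 p o i j k cp.
  rewrite ![o == _]eq_sym => /(_ io jo ko (ltW ij) (ltW jk)).
  rewrite orient_swap oppr_ge0 (ltW ki) => /(_ isT); rewrite (orient_split (p o)).
  by move: ij jk ki; rewrite /ccw; lra.
have le_tr : transitive le.
  move=> j i k; rewrite /le; have [//|io] := eqVneq i o.
  have [_|jo] /= := eqVneq j o; first by [].
  have [//|ko] /= := eqVneq k o.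
  case/orP => [/eqP -> //|ij] /orP[/eqP <-|jk]; first by rewrite ij orbT.
  by rewrite (ccw_trans _ _ _ io jo ko ij jk) orbT.
have le_tot : total le.
  move=> i j; rewrite /le; have [//|io] := eqVneq i o.
  have [//|jo] /= := eqVneq j o; have [//|ij] /= := eqVneq i j.
  have := convex_orient_neq0 cp (_ : o != i) (_ : o != j) ij.
  rewrite ![o == _]eq_sym => /(_ io jo); rewrite /ccw [orient _ (p j) _]orient_swap oppr_gt0.
  by rewrite neq_lt orbC.
pose s := sort le (enum 'I_n.+1).
have us : uniq s by rewrite sort_uniq enum_uniq.
have szs : size s = n.+1 by rewrite size_sort size_enum_ord.
exists s; split=> // a b c ab bc cn.
have le_s x y : (x < y)%N -> (y < n.+1)%N -> le (nth o s x) (nth o s y) && (nth o s x != nth o s y).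
  move=> xy yn; have xn := ltn_trans xy yn; rewrite nth_uniq ?szs // (ltn_eqF xy) andbT.
  by apply: (sorted_ltn_nth le_tr o (sort_sorted le_tot _)); rewrite ?inE ?szs.
have := le_s _ _ ab (ltn_trans bc cn); have := le_s _ _ bc cn.
have := le_s _ _ (ltn_trans ab bc) cn.
rewrite -/o; move: (nth o s a) (nth o s b) (nth o s c) => x y z.
rewrite /le; have [->|yo] /= := eqVneq y o.
  by rewrite orbF => _ _ /andP[/eqP ->]; rewrite eqxx.
have [->|zo] /= := eqVneq z o.
  by rewrite orbF => /andP[/eqP ->]; rewrite eqxx.
have [->|xo] /= := eqVneq x o.
  by move=> _ /andP[/orP[/eqP ->|//]]; rewrite eqxx.
move=> /andP[/orP[/eqP -> //|xz xz']]; first by rewrite eqxx.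
move=> /andP[/orP[/eqP -> //|yz yz']]; first by rewrite eqxx.
move=> /andP[/orP[/eqP -> //|xy xy']]; first by rewrite eqxx.
rewrite lt_neqAle eq_sym convex_orient_neq0 //= leNgt; apply/negP => neg.
(* A clockwise triple would put [p y] inside the triangle of [o], [x], [z]. *)
have : orient (p o) (p x) (p z) <= 0.
  apply: (convex_not_triangle (i := y) cp) => //; first by rewrite eq_sym.
  - by rewrite orient_rot ltW.
  - by rewrite orient_rot orient_swap oppr_ge0 ltW.
  - by rewrite -orient_rot ltW.
by rewrite leNgt; move: xz; rewrite /ccw => ->.
Qed.

(** The diagonals of a convex quadrilateral meet; [S] is twice its area, and the parameters of the
    meeting point are ratios of areas. *)
Lemma segments_meet (a b c d : point R) :
  0 < orient a b c -> 0 < orient a b d -> 0 < orient a c d -> 0 < orient b c d ->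
  exists x, on_segment a c x /\ on_segment b d x.
Proof.
move=> abc abd acd bcd.
have e := orient_split a b c d.
set S := orient b c d + orient a b d.
have S0 : 0 < S by rewrite addr_gt0.
have nz : S != 0 by rewrite gt_eqF.
pose t := orient a b d / S; pose u := orient a b c / S.
have bnd v : 0 < v -> v < S -> 0 <= v / S /\ v / S <= 1.
  by move=> v0 vS; split; [apply: divr_ge0; apply: ltW | rewrite ler_pdivrMr // mul1r ltW].
have [t0 t1] : 0 <= t /\ t <= 1 by apply: bnd; rewrite // /S; lra.
have [u0 u1] : 0 <= u /\ u <= 1 by apply: bnd; rewrite // /S; lra.
have St : S * t = orient a b d by rewrite mulrC divfK.
have Su : S * u = orient a b c by rewrite mulrC divfK.
exists ((1 - t) * a.1 + t * c.1, (1 - t) * a.2 + t * c.2); split; first by exists t.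
exists u; do 2!split=> //.
have key x y z w : (S - orient a b d) * x + orient a b d * z =
    (S - orient a b c) * y + orient a b c * w ->
    (1 - t) * x + t * z = (1 - u) * y + u * w.
  move=> h; apply: (mulfI nz); transitivity ((S - S * t) * x + S * t * z); first by ring.
  by rewrite St h -Su; ring.
congr pair; apply: key; rewrite /S /orient; ring.
Qed.
End Geometry.

(** * From point sets to path systems *)

Lemma mem_zip_behead (T : eqType) (s : seq T) a b :
  ((a, b) \in zip s (behead s)) = infix [:: a; b] s.
Proof.
elim: s => [//|x [|y s] IH]; first by rewrite infixs1 /= eqseq_cons andbF.
by rewrite infix_consl [zip _ _]/= inE IH /= prefix0s andbT.
Qed.

Lemma path_edgesP n (s : seq 'I_n) (e : {set 'I_n}) :
  reflect (exists a b, adj s a b /\ e = [set a; b]) (e \in path_edges s).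
Proof.
rewrite inE; apply: (iffP hasP) => [[[a b] + /eqP ->] | [a [b [/orP[] ab ->]]]].
- by rewrite mem_zip_behead => ab; exists a, b; rewrite /adj ab.
- by exists (a, b); rewrite ?mem_zip_behead.
- by exists (b, a); rewrite ?mem_zip_behead //= setUC.
Qed.

Lemma path_edges_rev n (s : seq 'I_n) : path_edges (rev s) = path_edges s.
Proof.
apply/setP => e; apply/path_edgesP/path_edgesP => -[a [b [ab ->]]]; exists a, b; split=> //;
  by move: ab; rewrite adj_rev.
Qed.

Lemma adj_map (T U : eqType) (f : T -> U) s a b : adj s a b -> adj (map f s) (f a) (f b).
Proof.
case/orP => /infixP[s1 [s2 ->]]; rewrite map_cat; apply: adj_catr => /=.
  exact: adj_cons2.
by rewrite adjC adj_cons2.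
Qed.

Lemma mem_bigcup_seq (I : eqType) (T : finType) (F : I -> {set T}) (r : seq I) x :
  reflect (exists2 i, i \in r & x \in F i) (x \in \bigcup_(i <- r) F i).
Proof.
elim: r => [|i r IH]; first by rewrite big_nil inE; constructor; case.
rewrite big_cons inE; apply: (iffP orP) => [[xi|/IH[j jr xj]]|[j]].
- by exists i; rewrite ?mem_head.
- by exists j; rewrite // inE jr orbT.
- by rewrite inE => /orP[/eqP -> xi|jr xj]; [left|right; apply/IH; exists j].
Qed.

Lemma perm_flatten_map (T : eqType) (f : seq T -> seq T) (P : seq (seq T)) :
  (forall s, perm_eq (f s) s) -> perm_eq (flatten (map f P)) (flatten P).
Proof. by move=> fs; elim: P => //= s P IH; apply: perm_cat. Qed.

(** * Transport to the counterclockwise numbering *)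

Section Transfer.
Variables (R : realType) (n : nat) (p : 'I_n.+1 -> point R) (s : seq 'I_n.+1).
Hypotheses (us : uniq s) (szs : size s = n.+1).
Hypothesis ccw : forall a b c, a < b -> b < c -> c < n.+1 ->
  (0 < orient (p (nth ord0 s a)) (p (nth ord0 s b)) (p (nth ord0 s c)))%R.

Let vertex (k : nat) : 'I_n.+1 := nth ord0 s k.
Let rank (i : 'I_n.+1) : nat := index i s.

Let mem_s i : i \in s.
Proof.
have /uniq_min_size : {subset s <= enum 'I_n.+1} by move=> x _; rewrite mem_enum.
by case/(_ us); rewrite ?size_enum_ord ?szs // => _ ->; rewrite mem_enum.
Qed.

Let rankK : cancel rank vertex.
Proof. by move=> i; apply: nth_index. Qed.

Let rank_lt i : rank i < n.+1.
Proof. by rewrite -szs index_mem. Qed.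

Definition edges_of (P : seq (seq nat)) : {set {set 'I_n.+1}} :=
  \bigcup_(t <- P) path_edges (map vertex t).

(** Interlacing edges are the diagonals of a convex quadrilateral; they meet but have no common
    endpoint. *)
Lemma no_interlace E a b c d : non_crossing p E ->
  [set vertex a; vertex c] \in E -> [set vertex b; vertex d] \in E -> d < n.+1 ->
  ~~ [&& a < b, b < c & c < d].
Proof.
move=> nc ac bd dn; apply/and3P => -[ab bc cd].
have cn := ltn_trans cd dn; have bn := ltn_trans bc cn; have an := ltn_trans ab bn.
have neq x y : x < y -> y < n.+1 -> vertex x != vertex y.
  by move=> xy yn; rewrite nth_uniq ?szs ?(ltn_trans xy yn) // ltn_eqF.
have [x [xac xbd]] := segments_meet (ccw ab bc cn) (ccw ab (ltn_trans bc cd) dn)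
  (ccw (ltn_trans ab bc) cd dn) (ccw bc cd dn).
have disj m : m \in [set vertex a; vertex c] -> m \in [set vertex b; vertex d] -> False.
  have := neq _ _ ab bn; have := neq _ _ (ltn_trans ab (ltn_trans bc cd)) dn.
  have := neq _ _ bc cn; have := neq _ _ cd dn; rewrite !inE.
  move=> h1 h2 h3 h4 /orP[] /eqP -> /orP[] /eqP e.
  - by rewrite e eqxx in h4.
  - by rewrite e eqxx in h3.
  - by rewrite e eqxx in h2.
  - by rewrite e eqxx in h1.
have ne : [set vertex a; vertex c] != [set vertex b; vertex d].
  by apply/negP => /eqP e; apply: (disj (vertex a)); rewrite -?e !inE eqxx.
by have [m [mac mbd _]] := nc _ _ _ _ ac bd ne x xac xbd; apply: (disj m).
Qed.

(** Vertices are replaced by their ranks, and each path that is not normal is reversed, which leaves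
    its edges unchanged. *)
Lemma ncpws_system (E : {set {set 'I_n.+1}}) : ncpws p E ->
  exists2 P, path_system n.+1 P & E = edges_of P.
Proof.
move=> [nc [P [uP mP szP EP]]].
pose P1 := map (map rank) P.
pose orientp (t : seq nat) := if normal t then t else rev t.
have P1E : flatten P1 = map rank (flatten P) by rewrite map_flatten.
have perm_or : perm_eq (flatten (map orientp P1)) (flatten P1).
  by apply: perm_flatten_map => t; rewrite /orientp; case: ifP; rewrite ?perm_rev.
have uP1 : uniq (flatten P1) by rewrite P1E map_inj_uniq //; apply: can_inj rankK.
have adjE t a b : t \in P1 -> adj t a b -> [set vertex a; vertex b] \in E.
  case/mapP => u uinP -> ab; rewrite EP; apply/mem_bigcup_seq; exists u => //.
  apply/path_edgesP; exists (vertex a), (vertex b); split=> //.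
  by have := adj_map vertex ab; rewrite mapK.
have lt_P1 t a : t \in P1 -> a \in t -> a < n.+1.
  by case/mapP => u _ -> /mapP[i _ ->].
have ncP1 t t' : t \in P1 -> t' \in P1 -> noncross t t'.
  move=> tP t'P a b c d ac bd.
  have /andP[_ ct] := adj_mem ac; have /andP[_ dt'] := adj_mem bd.
  have acE := adjE _ _ _ tP ac; have bdE := adjE _ _ _ t'P bd.
  by rewrite (no_interlace nc acE bdE (lt_P1 _ _ t'P dt'))
    (no_interlace nc bdE acE (lt_P1 _ _ tP ct)).
have adj_or t a b : adj (orientp t) a b = adj t a b.
  by rewrite /orientp; case: ifP; rewrite ?adj_rev.
exists (map orientp P1); first split.
- by rewrite (perm_uniq perm_or).
- move=> k; rewrite (perm_mem perm_or) P1E mem_iota add0n.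
  apply/mapP/idP => [[i _ ->]|kn]; first exact: rank_lt.
  by exists (vertex k); rewrite // /rank index_uniq ?szs.
- apply/allP => _ /mapP[t tP1 ->]; rewrite /orientp; case: ifP => // nt.
  have := normal_or_rev (uniq_flatten_sub uP1 tP1) _ (ncP1 _ _ tP1 tP1).
  rewrite nt; apply; case/mapP: tP1 => u uinP ->; rewrite size_map.
  exact: (allP szP).
- move=> _ _ /mapP[t tP ->] /mapP[t' t'P ->]; apply: noncross_sub (ncP1 _ _ tP t'P) => a b;
  by rewrite adj_or.
rewrite EP /edges_of !big_map; apply: eq_bigr => u _.
have -> : path_edges u = path_edges (map vertex (map rank u)) by rewrite mapK.
by rewrite /orientp; case: ifP => // _; rewrite map_rev path_edges_rev.
Qed.

Lemma edges_of_sub P P' : {subset P <= P'} -> edges_of P \subset edges_of P'.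
Proof.
move=> PP'; apply/subsetP => e /mem_bigcup_seq[t tP et].
by apply/mem_bigcup_seq; exists t => //; apply: PP'.
Qed.

(** Each partition is sent to the word of a chosen path system. Equal words give the same paths,
    hence the same edges. *)
Lemma num_ncpws_le (u : R) : (0 < u)%R -> (2 * u < 1)%R ->
  ((num_ncpws p)%:R * u ^+ n.+1 <=
   (1 + u * (u / (1 - 2 * u) + (u / (1 - 2 * u)) ^+ 2)) ^+ n.+1)%R.
Proof.
move=> u0 u12.
have /choice[Q QE] : forall E, exists P,
    ncpws p E -> path_system n.+1 P /\ E = edges_of P.
  move=> E.
  have [/ncpws_system[P sysP EP]|nE] := pselect (ncpws p E); last by exists [::].
  by exists P.
pose f (E : {set {set 'I_n.+1}}) := [ffun i : 'I_n.+1 => bounded_code n.+1 (word (Q E) i)].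
have wle E (i : 'I_n.+1) : ncpws p E -> wsize (word (Q E) i) <= n.+1.
  case/QE => sys _; apply: leq_trans (sum_wsize sys).
  by rewrite (bigD1 i) //= leq_addr.
apply: (card_words u0 u12 (f := f)) => [E E'|E]; rewrite !inE.
  move=> /asboolP hE /asboolP hE' /ffunP eqf.
  have [sys EE] := QE _ hE; have [sys' EE'] := QE _ hE'.
  have eqw i : i < n.+1 -> word (Q E) i = word (Q E') i.
    move=> lt_i; have := eqf (Ordinal lt_i); rewrite !ffunE => eqt.
    rewrite -(bounded_codeK (wle E (Ordinal lt_i) hE)) -(bounded_codeK (wle E' (Ordinal lt_i) hE')).
    by rewrite eqt.
  rewrite EE EE'; apply/eqP; rewrite eqEsubset !edges_of_sub //.
    by apply: word_inj sys' sys _ => i lt_i; rewrite eqw.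
  exact: word_inj sys sys' eqw.
move=> /asboolP hE; have [sys _] := QE _ hE.
apply: leq_trans (sum_wsize sys); rewrite leq_eqVlt; apply/orP; left; apply/eqP.
by apply: eq_bigr => i _; rewrite ffunE /bcode_size bounded_codeK ?wle.
Qed.

End Transfer.

(** * The numerical bound *)

Local Open Scope ring_scope.

(* O^*(c^n): bounded by (polynomial in n) * c^n for all sufficiently large n,
   uniformly over all n-point sets in convex position. *)
Theorem theorem2 (R : realType) :
  exists (C : R) (k N : nat), forall (n : nat) (p : 'I_n -> point R),
    (N <= n)%N -> convex_position p ->
    (num_ncpws p)%:R <= C * n%:R ^+ k * (4610718614%:R / 1000000000%:R) ^+ n.
Proof.
(* The polynomial factor is the constant 1, and [N = 1] supplies the point around which the others
   are sorted. *)
exists 1, 0%N, 1%N => -[//|n] p _ cp; rewrite expr0 mulr1 mul1r.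
have [s [us szs ccw]] := cyclic_order cp.
(* Close to the minimizer of [(1 + u (T + T^2)) / u], where [2 * u] is the root of
   [4 (1 - y)^3 = y^2]. *)
pose u : R := 28398%:R / 100000%:R.
have u0 : 0 < u by rewrite /u; lra.
have u12 : 2 * u < 1 by rewrite /u; lra.
have := num_ncpws_le us szs ccw u0 u12.
rewrite -ler_pdivlMr ?exprn_gt0 // -expr_div_n => /le_trans; apply.
have TE : u / (1 - 2 * u) = 14199%:R / 21602%:R.
  have h : 1 - 2 * u != 0 by apply/eqP => e; move: u12; lra.
  by apply: (mulIf h); rewrite divfK // /u; lra.
(* It remains to compare the bases: [1 / u + T + T ^+ 2] against the stated constant, in rational
   arithmetic. *)
rewrite TE; apply: lerXn2r; rewrite ?nnegrE.
- by apply: divr_ge0; rewrite /u; lra.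
- lra.
- by rewrite ler_pdivrMr // /u; lra.
Qed.
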